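(* Let $L$ be a normal bimodal logic such that (1) $L$ contains $\mathbf K\times\mathbf{Diff}$, and (2) for every positive integer $k$ there are sets $U,V$ with $|V|\ge k$, $|U|\ge 2|V|$ such that $(U,U\times U)\times(V,\neq_V)$ is a frame for $L$. Then $L$ is not axiomatisable using finitely many propositional variables, i.e. there is no set $\Sigma$ of formulas containing altogether only finitely many distinct variables such that $L$ is the smallest normal bimodal logic containing $\Sigma$.
   Context: Bimodal formulas use variables, Boolean connectives and $\Box_h,\Box_v,\Diamond_h,\Diamond_v$, evaluated in frames $(W,R_h,R_v)$; a normal bimodal logic contains all tautologies and $\Box_i(p\to q)\to(\Box_ip\to\Box_iq)$ ($i=h,v$), closed under substitution, modus ponens and necessitation; a frame for $L$ is a frame validating all formulas of $L$. The product of unimodal frames $(U,R)$ and $(V,S)$ is the frame $(U\times V,\bar R_h,\bar R_v)$ with $(x,y)\bar R_h(x',y')$ iff $xRx'$ and $y=y'$, and $(x,y)\bar R_v(x',y')$ iff $ySy'$ and $x=x'$. $U\times U$ is the universal relation on $U$ and $\neq_V$ is inequality on $V$. $\mathbf K\times\mathbf{Diff}$ is the set of formulas valid in all products $(U,R)\times(V,S)$ where $(U,R)$ is an arbitrary unimodal frame and $S$ is symmetric and pseudo-transitive ($ySy'\wedge y'Sy''\to(y=y''\vee ySy'')$). *)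

(* Defs.v *)
From mathcomp Require Import all_boot.
From mathcomp Require Export boolp classical_sets functions cardinality.

Set Implicit Arguments.
Unset Strict Implicit.
Unset Printing Implicit Defensive.

Local Open Scope classical_set_scope.

(** * Syntax *)

Inductive direction := horizontal | vertical.

(* [Bot] and [Imp] generate all Boolean connectives; as usual for normal modal
   logics, diamonds are duals of boxes. *)
Inductive formula :=
  | Var of nat
  | Bot
  | Imp of formula & formula
  | Box of direction & formula.

Definition Neg (a : formula) := Imp a Bot.
Definition And (a b : formula) := Neg (Imp a (Neg b)).
Definition Or (a b : formula) := Imp (Neg a) b.
Definition Dia (d : direction) (a : formula) := Neg (Box d (Neg a)).

Fixpoint vars (a : formula) : seq nat :=
  match a with
  | Var p => [:: p]
  | Bot => [::]
  | Imp b c => vars b ++ vars c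
  | Box _ b => vars b
  end.

Fixpoint subst (s : nat -> formula) (a : formula) : formula :=
  match a with
  | Var p => s p
  | Bot => Bot
  | Imp b c => Imp (subst s b) (subst s c)
  | Box d b => Box d (subst s b)
  end.

(** * Normal bimodal logics *)

(* Boxed subformulas are treated as propositional atoms, so a tautology is a
   substitution instance of a tautology of classical propositional logic. *)
Fixpoint truth_value (v : formula -> bool) (a : formula) : bool :=
  match a with
  | Bot => false
  | Imp b c => truth_value v b ==> truth_value v c
  | Var _ | Box _ _ => v a
  end.

Definition tautology (a : formula) := forall v, truth_value v a.

Definition K_axiom (d : direction) : formula :=
  Imp (Box d (Imp (Var 0) (Var 1))) (Imp (Box d (Var 0)) (Box d (Var 1))).

Record normal_logic (L : set formula) : Prop := {
  logic_taut : forall a, tautology a -> L a;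
  logic_K : forall d, L (K_axiom d);
  logic_subst : forall s a, L a -> L (subst s a);
  logic_mp : forall a b, L (Imp a b) -> L a -> L b;
  logic_nec : forall d a, L a -> L (Box d a)
}.

Definition axiomatises (Sigma L : set formula) : Prop :=
  [/\ normal_logic L, Sigma `<=` L &
      forall L', normal_logic L' -> Sigma `<=` L' -> L `<=` L'].

Definition finitely_many_variables (Sigma : set formula) : Prop :=
  finite_set (\bigcup_(a in Sigma) [set` vars a]).

(** * Frames *)

(* The empty frame is not excluded; it validates every formula. *)
Record frame1 := Frame1 {
  point1 : Type;
  rel1 : point1 -> point1 -> Prop
}.

Record frame2 := Frame2 {
  point : Type;
  rel_h : point -> point -> Prop;
  rel_v : point -> point -> Prop
}.

Definition rel_of (F : frame2) (d : direction) : point F -> point F -> Prop :=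
  match d with horizontal => @rel_h F | vertical => @rel_v F end.

Fixpoint sat (F : frame2) (v : nat -> set (point F)) (w : point F)
    (a : formula) : Prop :=
  match a with
  | Var p => v p w
  | Bot => False
  | Imp b c => sat v w b -> sat v w c
  | Box d b => forall w', rel_of d w w' -> sat v w' b
  end.

Definition valid (F : frame2) (a : formula) : Prop :=
  forall (v : nat -> set (point F)) (w : point F), sat v w a.

Definition frame_for (F : frame2) (L : set formula) : Prop :=
  forall a, L a -> valid F a.

Definition product (F G : frame1) : frame2 := {|
  point := (point1 F * point1 G)%type;
  rel_h := fun p q => rel1 p.1 q.1 /\ p.2 = q.2;
  rel_v := fun p q => rel1 p.2 q.2 /\ p.1 = q.1
|}.

Definition universal_frame (U : Type) : frame1 := Frame1 (fun _ _ : U => True).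

Definition inequality_frame (V : Type) : frame1 :=
  Frame1 (fun x y : V => x <> y).

Definition pseudo_transitive (T : Type) (S : T -> T -> Prop) : Prop :=
  forall x y z, S x y -> S y z -> x = z \/ S x z.

Definition diff_frame (G : frame1) : Prop :=
  (forall x y : point1 G, rel1 x y -> rel1 y x) /\
  pseudo_transitive (@rel1 G).

Definition K_x_Diff : set formula :=
  [set a | forall F G : frame1, diff_frame G -> valid (product F G) a].

(* Main.v *)
(* Fix finitely many variables, and let [N] exceed the number of sets of these
   variables.  Consider the frame with two vertical [<>]-clusters, of [N] and
   [N.+1] points, in which [R_h] is universal.  Counting the points of the
   columns refutes on it a formula of K x Diff with [N.+1] variables.  On the
   other hand, under a valuation of the fixed variables each of the two columns
   has two points that agree on them, so that it is indistinguishable from any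
   larger column obtained by repeating one of these points.  Hence the model is
   bisimilar to a model on [(U, U x U) x (V, <>)] for all large [V]: each of the
   two columns occurs in [|V|] rearrangements, so that every point of it appears
   in every row, which is where [2|V| <= |U|] comes from.  So the frame validates
   the formulas of [L] in the fixed variables, but not all of [L]. *)
Require Import Defs.
From mathcomp Require Import all_boot zify.

Set Implicit Arguments.
Unset Strict Implicit.
Unset Printing Implicit Defensive.

Local Open Scope classical_set_scope.
Local Open Scope card_scope.

(** * Finite blocks and Latin labellings *)

Lemma card_leT_inj (S T : Type) :
  [set: S] #<= [set: T] -> exists f : S -> T, injective f.
Proof.
move=> /card_leP[f].
have sT (x : S) : x \in [set: S] by apply: mem_set.
exists (fun x => val (f (SigSub (sT x)))) => x y /val_inj fxy.
by have [] := @inj _ _ _ f _ _ (mem_set I) (mem_set I) fxy.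
Qed.

Lemma bounded_uniq_finite (T : eqType) (D : set T) (k : nat) :
    (forall t : seq T, uniq t -> {in t, forall x, D x} -> (size t < k)%N) ->
  exists d : seq T, uniq d /\ forall x, D x <-> x \in d.
Proof.
move=> Dk; apply: contrapT => Dinf.
suff /(_ k)[t [/Dk tk tD szt]] : forall n, exists t : seq T,
    [/\ uniq t, {in t, forall x, D x} & size t = n].
  by have := tk tD; rewrite szt ltnn.
elim=> [|n [t [Ut tD szt]]]; first by exists [::].
have [x [Dx xt]] : exists x, D x /\ x \notin t.
  apply: contrapT => nox; apply: Dinf; exists t; split=> // x; split=> [Dx|/tD//].
  by apply: contrapT => /negP xt; apply: nox; exists x.
exists (x :: t); split=> /=; rewrite ?xt ?szt // => y.
by rewrite inE => /predU1P[->|/tD].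
Qed.

(* By Zorn's lemma there is a maximal family of disjoint blocks; the fewer than
   [k] points that it misses are added to one of the blocks. *)
Lemma finite_block_partition (T : eqType) (k : nat) (s0 : seq T) :
    (0 < k)%N -> uniq s0 -> (k <= size s0)%N ->
  exists block : T -> seq T, forall x,
    [/\ uniq (block x), (k <= size (block x))%N, x \in block x &
        {in block x, forall y, block y = block x}].
Proof.
move=> k_gt0 Us0 ks0.
pose P (X : set (seq T)) :=
  (forall s, X s -> uniq s /\ (k <= size s)%N) /\
  (forall s t x, X s -> X t -> x \in s -> x \in t -> s = t).
have [|X [[Xblock Xdisj] Xmax]] := @Zorn_bigcup _ P.
  move=> F FP Ftot; split=> [s [X FX Xs]|s t x [X FX Xs] [Y FY Yt] xs xt].
    by have [/(_ s Xs)] := FP _ FX.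
  have [XY|YX] := Ftot _ _ FX FY.
    by have [_ /(_ s t x)] := FP _ FY; apply => //; apply: XY.
  by have [_ /(_ s t x)] := FP _ FX; apply => //; apply: YX.
pose D x := forall s, X s -> x \notin s.
have [t Ut tD|d [Ud dD]] := @bounded_uniq_finite _ D k.
  rewrite ltnNge; apply/negP => kt.
  have tnX : ~ X t.
    case: t kt Ut tD => [|x t] //=; first by rewrite leqNgt k_gt0.
    by move=> _ _ /(_ x (mem_head _ _)) /(_ (x :: t)) xD /xD; rewrite mem_head.
  apply: (Xmax (X `|` [set t])); first split; first by move=> s; left.
    by move=> /(_ t) Xt; apply/tnX/Xt; right.
  split=> [s [/Xblock//|->//]|s s' x].
  move=> [Xs|->] [Xs'|->] // xs xs'; first exact: Xdisj xs xs'.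
    by have := tD _ xs' _ Xs; rewrite xs.
  by have := tD _ xs _ Xs'; rewrite xs'.
(* Were the maximal family empty, [s0] alone would enlarge it. *)
have [b Xb] : exists b, X b.
  apply: contrapT => noX.
  apply: (Xmax [set s0]); first split.
  - by move=> s Xs; case: noX; exists s.
  - by move/(_ s0 erefl) => Xs0; case: noX; exists s0.
  - by split=> [s ->//|s s' x -> ->].
pose B s := if s == b then s ++ d else s.
have UB s : X s -> uniq (B s).
  move=> Xs; rewrite /B; case: eqP => [_|_]; last by have [] := Xblock _ Xs.
  rewrite cat_uniq Ud; have [-> _] := Xblock _ Xs; rewrite andbT /=.
  by apply/hasPn => x /dD /(_ _ Xs).
have kB s : X s -> (k <= size (B s))%N.
  move=> Xs; have [_ ks] := Xblock _ Xs; rewrite /B; case: eqP => // _.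
  by rewrite size_cat (leq_trans ks) ?leq_addr.
have Bcase s x : x \in B s -> x \in s \/ s = b /\ x \in d.
  rewrite /B; case: eqP => [->|_]; last by left.
  by rewrite mem_cat => /orP[]; [left|right].
have Bdisj s t x : X s -> X t -> x \in B s -> x \in B t -> s = t.
  move=> Xs Xt /Bcase[xs|[-> xd]] /Bcase[xt|[-> xd']] //.
  - exact: Xdisj xs xt.
  - by have /(_ _ Xs) := (dD x).2 xd'; rewrite xs.
  - by have /(_ _ Xt) := (dD x).2 xd; rewrite xt.
have cover x : exists s, X s /\ x \in B s.
  have [/dD xd|] := pselect (D x).
    by exists b; split=> //; rewrite /B eqxx mem_cat xd orbT.
  apply: contra_notP => noB s Xs; apply/negP => xs; apply: noB; exists s; split=> //.
  by rewrite /B; case: eqP => //; rewrite mem_cat xs.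
have [f fP] := choice cover.
exists (B \o f) => x /=; have [Xx xx] := fP x; split; [exact: UB|exact: kB|by []|].
by move=> y yx; have [Xy yy] := fP y; rewrite (Bdisj _ _ _ Xy Xx yy yx).
Qed.

Lemma rot_index (T : eqType) (s : seq T) (x : T) (i : nat) :
    uniq s -> x \in s -> (i < size s)%N ->
  exists2 y, y \in s & index x (rot (index y s) s) = i.
Proof.
(* [j] is the position [i] places before [x] in cyclic order. *)
move=> Us xs si; pose j := ((if i <= index x s then 0 else size s) + index x s - i)%N.
have sx : (index x s < size s)%N by rewrite index_mem.
have sj : (j < size s)%N by rewrite /j; case: ifP; lia.
exists (nth x s j); rewrite ?mem_nth // index_uniq //.
have <- : nth x (rot j s) i = x; last by rewrite index_uniq ?rot_uniq ?size_rot.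
rewrite /rot nth_cat size_drop nth_drop; case: ltnP => ij.
  rewrite (_ : (j + i)%N = index x s) ?nth_index //.
  by move: ij; rewrite /j; case: ifP; lia.
rewrite nth_take; last lia.
rewrite (_ : (i - (size s - j))%N = index x s) ?nth_index //.
by move: ij; rewrite /j; case: ifP; lia.
Qed.

(** Row [z] lists the finite block of [z], rotated so as to start at [z]; the rotations bring each
    point of a block to every position. Points outside the block get its size as label, which is at
    least [k] and so cannot clash with a label below [k]. *)
Lemma latin_labelling (T : Type) (k : nat) :
    [set: 'I_k] #<= [set: T] ->
  exists f : T -> T -> nat,
    [/\ forall z i, (i < k)%N -> exists x, f z x = i,
        forall z x y, (f z x < k)%N -> f z x = f z y -> x = y &
        forall x i, (i < k)%N -> exists z, f z x = i].
Proof.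
elim/Peq: T => T /card_leT_inj[e e_inj].
have [->|k_gt0] := posnP k; first by exists (fun _ _ => 0%N).
have [||block blockP] := @finite_block_partition T k (codom e) k_gt0.
- by rewrite map_inj_uniq ?enum_uniq.
- by rewrite size_codom card_ord.
exists (fun z x => index x (rot (index z (block z)) (block z))).
split=> [z i ik|z x y|x i ik].
- have [Uz kz _ _] := blockP z.
  exists (nth z (rot (index z (block z)) (block z)) i).
  by rewrite index_uniq ?rot_uniq ?size_rot // (leq_trans ik).
- have [_ kz _ _] := blockP z => fk fxy.
  have mem w : (index w (rot (index z (block z)) (block z)) < k)%N ->
      w \in rot (index z (block z)) (block z).
    by move=> wk; rewrite -index_mem size_rot (leq_trans wk).
  by apply: (index_inj x (mem _ fk) _ fxy); apply: mem; rewrite -fxy.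
- have [Ux kx xx bx] := blockP x.
  have [z zx <-] := rot_index Ux xx (leq_trans ik kx).
  by exists z; rewrite bx.
Qed.

(** * Bisimulation and validity in frames *)

Lemma sat_bisimilar (F G : frame2) (v : nat -> set (point F))
    (v' : nat -> set (point G)) (Z : point F -> point G -> Prop) (vs : seq nat) :
    (forall p q n, Z p q -> n \in vs -> v n p <-> v' n q) ->
    (forall d p q p', Z p q -> rel_of d p p' -> exists2 q', rel_of d q q' & Z p' q') ->
    (forall d p q q', Z p q -> rel_of d q q' -> exists2 p', rel_of d p p' & Z p' q') ->
  forall a, {subset vars a <= vs} ->
  forall p q, Z p q -> sat v p a <-> sat v' q a.
Proof.
move=> atoms forth back; elim=> [n|//|b IHb c IHc|d b IHb] /= avs p q Zpq.
- by apply: atoms => //; apply: avs; rewrite mem_head.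
- have [|bpq qbp] := IHb _ p q Zpq.
    by move=> n nb; apply: avs; rewrite mem_cat nb.
  have [|cpq qcp] := IHc _ p q Zpq.
    by move=> n nc; apply: avs; rewrite mem_cat nc orbT.
  by split=> bc /[dup] ? ?; [apply/cpq/bc/qbp|apply/qcp/bc/bpq].
- split=> H w R.
    by have [w' R' Zw] := back _ _ _ _ Zpq R; apply/(IHb avs _ _ Zw)/H.
  by have [w' R' Zw] := forth _ _ _ _ Zpq R; apply/(IHb avs _ _ Zw)/H.
Qed.

(** Unlike the columns of a product, the fibres of [col] need not be copies of one another. *)
Definition column_frame (P C : Type) (col : P -> C) : frame2 := {|
  point := P;
  rel_h := fun _ _ => True;
  rel_v := fun p q => col p = col q /\ p <> q
|}.

(* A valuation of few variables makes two points of each column of [col]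
   indistinguishable, so that either of them may be repeated at will. *)
Lemma column_frame_valid (P : finType) (col : P -> bool) (vs : seq nat)
    (U V : Type) (a : formula) :
    (forall b, (2 ^ size vs < #|[pred p | col p == b]|)%N) ->
    [set: 'I_#|P|] #<= [set: V] -> [set: (V + V)%type] #<= [set: U] ->
    {subset vars a <= vs} ->
    valid (product (universal_frame U) (inequality_frame V)) a ->
  valid (column_frame col) a.
Proof.
move=> large PV VU avs prod_a v w.
have [f [f_onto f_inj f_all]] := latin_labelling PV.
have [z0] : inhabited V 
  by have [e _] := card_leT_inj PV; exact: (inhabits (e (enum_rank w))).
pose theta (p : P) := map_tuple (fun n => `[< v n p >]) (in_tuple vs).
have theta_atom p q n : theta p = theta q -> n \in vs -> v n p <-> v n q.
  move=> /(congr1 val)/eq_in_map/[apply] pq.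
  by split=> /asboolP; [rewrite pq|rewrite -pq] => /asboolP.
(* Pigeonhole: column [b] has more points than there are values of [theta], so it contains twins. *)
have /choice[t tP] b : exists t : P * P,
    [/\ col t.1 = b, col t.2 = b, t.1 <> t.2 & theta t.1 = theta t.2].
  have /dinjectivePn[p /eqP pb [q /andP[/= qp /eqP qb] pq]] :
      ~~ dinjectiveb theta [pred p | col p == b].
    apply/dinjectiveP => /card_in_image/(congr1 (leq ^~ (2 ^ size vs)%N)).
    rewrite [RHS]leqNgt large => /negP; apply.
    by rewrite (leq_trans (max_card _)) ?card_tuple ?card_bool.
  by exists (p, q); split=> //=; apply/eqP; rewrite eq_sym.
(* [r x] tells which column, in which arrangement, is laid over [x]. Points of [U] outside the image
   of [e] take the default [(true, z0)]. *)
have [r r_onto] : exists r : U -> bool * V, forall b z, exists x, r x = (b, z).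
  have [e e_inj] := card_leT_inj VU.
  pose dec (s : V + V) := match s with inl z => (true, z) | inr z => (false, z) end.
  have /choice[r rP] x : exists c, forall s, e s = x -> dec s = c.
    have [[s <-]|nx] := pselect (exists s, e s = x).
      by exists (dec s) => s' /e_inj ->.
    by exists (true, z0) => s sx; case: nx; exists s.
  by exists r => b z; exists (e (if b then inl z else inr z));
    rewrite -(rP _ _ erefl); case: b.
pose E b := enum [pred p | col p == b].
have memE p b : (p \in E b) = (col p == b) by rewrite mem_enum.
have Ek b i : (i < size (E b))%N -> (i < #|P|)%N.
  by move=> iE; rewrite (leq_trans iE) // -cardE max_card.
(* Labels beyond the end of [E b] default to the first twin, which thus fills all surplus places;
   every other point of the column occurs exactly once in each arrangement. *)
pose g b z y := nth (t b).1 (E b) (f z y).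
have gcol b z y : col (g b z y) = b.
  have [tb _ _ _] := tP b; have [yE|yE] := ltnP (f z y) (size (E b)).
    by apply/eqP; rewrite -memE mem_nth.
  by rewrite /g nth_default.
have g_onto z p : exists y, g (col p) z y = p.
  have pE : p \in E (col p) by rewrite memE.
  have [|y fy] := f_onto z (index p (E (col p))).
    by apply: (Ek (col p)); rewrite index_mem.
  by exists y; rewrite /g fy nth_index.
have g_all y p : exists z, g (col p) z y = p.
  have pE : p \in E (col p) by rewrite memE.
  have [|z fz] := f_all y (index p (E (col p))).
    by apply: (Ek (col p)); rewrite index_mem.
  by exists z; rewrite /g fz nth_index.
have g_inj b z y y' : g b z y = g b z y' -> y = y' \/ g b z y = (t b).1.
  rewrite /g; have [yE|yE] := ltnP (f z y) (size (E b)); last first.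
    by right; rewrite nth_default.
  have [yE'|yE'] := ltnP (f z y') (size (E b)); last first.
    by move=> ->; right; rewrite nth_default.
  move=> /eqP; rewrite nth_uniq ?enum_uniq // => /eqP.
  by move=> /(f_inj _ _ _ (Ek _ _ yE)); left.
pose h (u : U * V) := g (r u.1).1 (r u.1).2 u.2.
pose F := product (universal_frame U) (inequality_frame V).
(* Equality [h u = p] would not do: copies of the first twin see each other vertically, while the
   twin does not see itself. *)
pose Z (u : point F) (p : point (column_frame col)) :=
  (r u.1).1 = col p /\ theta (h u) = theta p.
have [z gz] := g_all z0 w; have [x rx] := r_onto (col w) z.
have Zw : Z (x, z0) w by rewrite /Z /h /= rx /= gz.
rewrite -(@sat_bisimilar F _ (fun n u => v n (h u)) v Z vs _ _ _ a avs _ _ Zw).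
- exact: prod_a.
- by move=> u p n [_] /theta_atom; apply.
- move=> [] /= u p u' [ru up].
  + by move=> _; exists (h u'); rewrite // /Z /h gcol.
  + move=> [uu' ruu]; have cup : col (h u') = col p by rewrite /h gcol -ruu.
    have Zp : Z u' (h u') by rewrite /Z cup -ruu.
    (* The successor [h u'] is ruled out only if it equals [p]. Then [h u] replaces it, having the
       same value of [theta]; if [h u] is [p] too, then [p] is the repeated first twin and the
       second one serves. *)
    have [hp|hp] := eqVneq (h u') p; last first.
      by exists (h u') => //; split=> // /esym/eqP; rewrite (negPf hp).
    have [hu|hu] := eqVneq (h u) p; last first.
      exists (h u); last by rewrite /Z up -hp /h gcol -ruu.
      by split=> [|/esym/eqP]; rewrite ?(negPf hu) // /h gcol.
    have [||ht] := g_inj (r u.1).1 (r u.1).2 u.2 u'.2.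
    * by rewrite -/(h u) hu -hp /h -ruu.
    * by move=> ?; case: uu'.
    have [t1 t2 t12 tt] := tP (col p).
    have pt : p = (t (col p)).1 by rewrite -ru -ht -/(h u) hu.
    exists (t (col p)).2; first by split; rewrite ?t2 // {1}pt.
    by rewrite /Z t2 -ruu -tt -pt hp.
- move=> [] /= u p q [ru up].
  (* The witness must lie in the row of [u], so the arrangement is chosen to put [q] there. *)
  + move=> _; have [z' gz'] := g_all u.2 q; have [x' rx'] := r_onto (col q) z'.
    by exists (x', u.2); rewrite // /Z /h /= rx' /= gz'.
  + move=> [pq p_neq_q].
    have [y hy] : exists y, h (u.1, y) = q by rewrite /h /= ru pq; apply: g_onto.
    (* If [q] sits at [u] itself, then [p] and [q] agree under [theta], and a place [y'] of [p]
       serves instead. *)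
    have [y_eq|y_neq] := pselect (u.2 = y); last first.
      by exists (u.1, y); rewrite // /Z hy ru pq.
    have [y' hy'] : exists y', h (u.1, y') = p by rewrite /h /= ru; apply: g_onto.
    exists (u.1, y').
      by split=> //= uy'; apply: p_neq_q; rewrite -hy' -hy -uy' y_eq.
    by rewrite /Z hy' /= ru pq -up -hy -y_eq; case: u {ru up y_eq hy hy'}.
Qed.

Lemma valid_normal (F : frame2) : normal_logic [set a | valid F a].
Proof.
split.
- move=> a taut_a v w; have <- : truth_value (fun b => `[< sat v w b >]) a <-> sat v w a.
    elim: a {taut_a} => [p||b IHb c IHc|d b _] /=.
    + by split=> /asboolP.
    + by [].
    + by rewrite -IHb -IHc; split=> [/implyP|bc]; last apply/implyP.
    + by split=> /asboolP.
  exact: taut_a.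
- by move=> d v w /= H1 H2 w' R; apply: H1 => //; apply: H2.
- move=> s a Fa v w.
  have <- : sat (fun p u => sat v u (s p)) w a <-> sat v w (subst s a).
    elim: a {Fa} w => [p||b IHb c IHc|d b IHb] w //=; first by rewrite IHb IHc.
    by split=> H u R; apply/IHb/H.
  exact: Fa.
- by move=> a b Fab Fa v w; apply: Fab; apply: Fa.
- by move=> d a Fa v w w' _; apply: Fa.
Qed.

(** * Formulas counting the points of a column *)

Fixpoint conj_below (n : nat) (f : nat -> formula) : formula :=
  if n is m.+1 then And (conj_below m f) (f m) else Neg Bot.

Definition disj_below (n : nat) (f : nat -> formula) : formula :=
  Neg (conj_below n (Neg \o f)).

(** The vertical relation need not be reflexive, so the current point is added. *)
Definition column_box (a : formula) : formula := And a (Box vertical a).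

Definition column_dia (a : formula) : formula := Neg (column_box (Neg a)).

Section Satisfaction.
Variables (F : frame2) (v : nat -> set (point F)).
Implicit Types (w : point F) (a b : formula).

Lemma sat_neg w a : sat v w (Neg a) <-> ~ sat v w a.
Proof. by []. Qed.

Lemma sat_imp w a b : sat v w (Imp a b) <-> (sat v w a -> sat v w b).
Proof. by []. Qed.

Lemma sat_box d w a : sat v w (Box d a) <-> forall w', rel_of d w w' -> sat v w' a.
Proof. by []. Qed.

Lemma sat_and w a b : sat v w (And a b) <-> sat v w a /\ sat v w b.
Proof.
split=> [ab|[Ha Hb] ab]; last exact: ab Ha Hb.
by split; apply: contrapT => H; apply: ab => // ? ?; apply: H.
Qed.

Lemma sat_conj n (f : nat -> formula) w :
  sat v w (conj_below n f) <-> forall i, (i < n)%N -> sat v w (f i).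
Proof.
elim: n => [|n IHn]; first by split=> [_ i|_ []].
rewrite [conj_below _ _]/= sat_and IHn; split=> [[fi fn] i|fi].
  by rewrite ltnS leq_eqVlt => /predU1P[->|/fi].
by split=> [i i_n|]; apply: fi; rewrite ?ltnS // ltnW.
Qed.

Lemma sat_disj n (f : nat -> formula) w :
  sat v w (disj_below n f) <-> exists2 i, (i < n)%N & sat v w (f i).
Proof.
rewrite sat_neg sat_conj; split=> [nf|[i i_n fi] /(_ i i_n)]; last exact.
by apply: contrapT => nex; apply: nf => i i_n fi; apply: nex; exists i.
Qed.

Lemma sat_column_box a w :
  sat v w (column_box a) <-> forall w', w = w' \/ rel_v w w' -> sat v w' a.
Proof.
rewrite sat_and /=; split=> [[aw aR] w' [<-|/aR]//|H].
by split=> [|w' R]; apply: H; [left|right].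
Qed.

Lemma sat_column_dia a w :
  sat v w (column_dia a) <-> exists2 w', w = w' \/ rel_v w w' & sat v w' a.
Proof.
rewrite sat_neg sat_column_box; split=> [na|[w' R aw'] /(_ w' R)]; last exact.
by apply: contrapT => nex; apply: na => w' R aw'; apply: nex; exists w'.
Qed.

End Satisfaction.

Definition column_at_most (n : nat) : formula :=
  And (column_box (disj_below n Var))
      (conj_below n (fun i => column_box (Imp (Var i) (Box vertical (Neg (Var i)))))).

(* The points of the column are told apart by the least variable true at them. *)
Definition column_at_least (n : nat) : formula :=
  conj_below n (fun j => column_dia (And (Var j) (conj_below j (fun i => Neg (Var i))))).

Definition no_larger_column (n : nat) : formula :=
  Imp (column_at_most n) (Box horizontal (Neg (column_at_least n.+1))).

(** The heights [c j] witnessing the larger column are carried over to the column of [x], where each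
    makes a variable below [n] true; distinct ones get distinct variables, against the pigeonhole
    principle. *)
Lemma no_larger_column_K_x_Diff (n : nat) : K_x_Diff (no_larger_column n).
Proof.
move=> F G [Gsym Gtrans] v [x y].
apply/sat_imp => /sat_and[/sat_column_box cover /sat_conj unique].
apply/sat_box => -[x' y'] [xx' yy'].
have {yy'} <- : y = y' := yy'; apply/sat_neg => /sat_conj large.
have /choice[c cP] (j : 'I_n.+1) : exists z, (y = z \/ rel1 y z) /\
    v j (x', z) /\ forall i, (i < j)%N -> ~ v i (x', z).
  have /sat_column_dia[[x1 z] R /sat_and[vj /sat_conj vi]] := large j (ltn_ord j).
  have [xx1 yz] : x' = x1 /\ (y = z \/ rel1 y z).
    by case: R => [[-> ->]|[yz xx1]]; split=> //; [left|right].
  by exists z; split=> //; rewrite xx1.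
have /choice[l lP] (j : 'I_n.+1) : exists i : 'I_n, v i (x, c j).
  have [|i i_n vi] := (sat_disj _ _ _ _).1 (cover (x, c j) _).
    by have [[->|R] _] := cP j; [left|right].
  by exists (Ordinal i_n).
have l_lt (i j : 'I_n.+1) : (i < j)%N -> l i <> l j.
  move=> ij lij; have [Ri [vi _]] := cP i; have [Rj [_ /(_ i ij) vj]] := cP j.
  (* The least variable true at [(x', c j)] is [j], whereas [i < j] is true at [(x', c i)]. *)
  have cij : c i <> c j by move=> cij; apply: vj; rewrite -cij.
  have Rij : rel1 (c i) (c j).
    case: Ri Rj => [yi|Ri] [yj|Rj].
    - by case: cij; rewrite -yi.
    - by rewrite -yi.
    - by rewrite -yj; apply: Gsym.
    - by have [] := Gtrans _ _ _ (Gsym _ _ Ri) Rj.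
  have /sat_column_box/(_ (x, c i)) H := unique (l i) (ltn_ord _).
  apply: (H _ (lP i) (x, c j)) => //=; last by rewrite lij; apply: lP.
  by case: Ri => [->|R]; [left|right].
suff /leq_card : injective l by rewrite !card_ord ltnn.
by move=> i j lij; apply/val_inj; case: (ltngtP i j) => // /l_lt; rewrite lij.
Qed.

Definition left_column (m n : nat) (p : 'I_m + 'I_n) : bool :=
  if p is inl _ then true else false.

(** [Var i] names the [i]-th point of both columns. The refutation starts at a point of the smaller
    one, hence [0 < n]. *)
Lemma no_larger_column_refuted (n : nat) :
  (0 < n)%N -> ~ valid (column_frame (@left_column n n.+1)) (no_larger_column n).
Proof.
move=> n_gt0.
pose v i (p : 'I_n + 'I_n.+1) := i = match p with inl j => j : nat | inr j => j end.
move=> /(_ v (inl (Ordinal n_gt0)))/sat_imp H.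
suff /H/sat_box/(_ (inr ord0) I)/sat_neg :
    sat (F := column_frame (@left_column n n.+1)) v (inl (Ordinal n_gt0))
      (column_at_most n).
  apply; apply/sat_conj => j j_n; apply/sat_column_dia; exists (inr (Ordinal j_n)).
    have [->|jn0] := eqVneq (Ordinal j_n) ord0; [by left|right].
    by split=> // -[j0]; rewrite -val_eqE /= -j0 in jn0.
  apply/sat_and; split=> //; apply/sat_conj => i ij; apply/sat_neg => /= iE.
  by rewrite /v /= in iE; rewrite iE ltnn in ij.
apply/sat_and; split.
  apply/sat_column_box => -[j|j] H'; last by case: H' => [|[]].
  by apply/sat_disj; exists j.
apply/sat_conj => i i_n; apply/sat_column_box => -[j|j] H'; last by case: H' => [|[]].
move=> ij [j'|j'] [//= _ jj'] ij'; apply: jj'; congr inl.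
by apply/val_inj; rewrite /= -ij'.
Qed.

Theorem theorem5p1 (L : set formula)
    (L_normal : normal_logic L)
    (L_KDiff : K_x_Diff `<=` L)
    (L_frames : forall k : nat, (0 < k)%N ->
       exists U V : Type,
         [/\ [set: 'I_k] #<= [set: V],
             [set: (V + V)%type] #<= [set: U] &
             frame_for (product (universal_frame U) (inequality_frame V)) L]) :
  ~ exists Sigma : set formula,
      finitely_many_variables Sigma /\ axiomatises Sigma L.
Proof.
case=> Sigma [/finite_seqP[vs vsE] [_ SigmaL Lmin]].
(* Large enough for even the smaller column to contain twins. *)
set n := (2 ^ size vs).+1.
pose col := @left_column n n.+1.
(* By minimality of [L], a frame validating [Sigma] validates all of [L]. *)
suff SigmaF : Sigma `<=` [set a | valid (column_frame col) a].
  apply: (@no_larger_column_refuted n isT).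
  have Ln := L_KDiff _ (@no_larger_column_K_x_Diff n).
  exact: (Lmin _ (valid_normal (column_frame col)) SigmaF _ Ln).
move=> a Sa.
(* The total number of points bounds the positions in either column. *)
have [|U [V [nV VU UV_L]]] := L_frames #|{: 'I_n + 'I_n.+1}|.
  by rewrite card_sum !card_ord.
apply: (@column_frame_valid _ _ vs U V) => //; last exact/UV_L/SigmaL.
- move=> b.
  pose e (i : 'I_n) : 'I_n + 'I_n.+1 :=
    if b then inl i else inr (widen_ord (leqnSn n) i).
  have e_inj : injective e.
    by rewrite /e; case: (b) => i j => [[]|[/val_inj]].
  rewrite -[(2 ^ _).+1]/n -[n in (n <= _)%N]card_ord -(card_codom e_inj).
  by apply/subset_leq_card/subsetP => _ /codomP[i ->]; rewrite inE /e; case: (b).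
- by move=> p pa; have : [set` vs] p by rewrite -vsE; exists a.
Qed.
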